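(* Let $(\bar x,\bar y,\bar z,\bar u,\bar v)$ be a KKT point of (WDP). If $(\bar x,\bar y,\bar z,\bar u,\bar v)$ is feasible to (MDP), then it is also a KKT point of (MDP).
   Context: Data: $F:\mathbb{R}^{n+m}\to\mathbb{R}$ is continuously differentiable; $f:\mathbb{R}^{n+m}\to\mathbb{R}$, $g:\mathbb{R}^{n+m}\to\mathbb{R}^p$, $h:\mathbb{R}^{n+m}\to\mathbb{R}^q$ are twice continuously differentiable. $\nabla_z$ denotes the gradient with respect to the second block of variables, and for vector-valued maps the matrix whose columns are the gradients of the components. There is no upper-level constraint (i.e. $\Omega=\mathbb{R}^{n+m}$). Both problems below are over $(x,y,z,u,v)\in\mathbb{R}^n\times\mathbb{R}^m\times\mathbb{R}^m\times\mathbb{R}^p\times\mathbb{R}^q$. (WDP): $\min F(x,y)$ s.t. $g(x,y)\le0$, $h(x,y)=0$, $f(x,y)-f(x,z)-u^Tg(x,z)-v^Th(x,z)\le0$, $\nabla_zf(x,z)+\nabla_zg(x,z)u+\nabla_zh(x,z)v=0$, $u\ge0$. (MDP): $\min F(x,y)$ s.t. $g(x,y)\le0$, $h(x,y)=0$, $f(x,y)-f(x,z)\le0$, $u^Tg(x,z)+v^Th(x,z)\ge0$, $\nabla_zf(x,z)+\nabla_zg(x,z)u+\nabla_zh(x,z)v=0$, $u\ge0$. KKT point: for a problem $\min\Phi(w)$ s.t. $G(w)\le0$, $H(w)=0$ with continuously differentiable data, a feasible point $\bar w$ is a KKT point if there exist multipliers $\lambda\ge0$ and $\mu$ with $\nabla\Phi(\bar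 w)+\nabla G(\bar w)\lambda+\nabla H(\bar w)\mu=0$ and $\lambda^TG(\bar w)=0$. *)

(* Defs.v *)
From HB Require Import structures.
From mathcomp Require Import all_boot all_order all_algebra.
From mathcomp Require Import all_classical all_reals all_analysis.

Set Implicit Arguments.
Unset Strict Implicit.
Unset Printing Implicit Defensive.

Import Order.TTheory GRing.Theory Num.Theory.
Import numFieldNormedType.Exports.

Local Open Scope classical_set_scope.
Local Open Scope ring_scope.

(* Points of R^N are row vectors. Gradients are columns, and the gradient of a
   vector-valued map is the library's ['J G w], whose (i, j) entry is the
   derivative of the j-th component along the i-th axis (see [col_jacobian]). *)

Definition dot (R : realType) (k : nat) (a b : 'rV[R]_k) : R :=
  \sum_(i < k) a 0 i * b 0 i.

Definition grad (R : realType) (N : nat) (f : 'rV[R]_N -> R) (w : 'rV[R]_N) :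
    'cV[R]_N :=
  \col_i 'D_(delta_mx 0 i) f w.

Lemma col_jacobian (R : realType) (N k : nat) (G : 'rV[R]_N -> 'rV[R]_k)
    (w : 'rV[R]_N) (j : 'I_k) :
  differentiable G w -> col j ('J G w) = grad (fun w' => G w' 0 j) w.
Proof.
move=> dG; apply/colP => i; rewrite !mxE.
have dGi : derivable G w (delta_mx 0 i) by exact: diff_derivable.
by rewrite -deriveE// derive_mx// mxE.
Qed.

Definition C1 (R : realType) (N : nat) (f : 'rV[R]_N -> R) : Prop :=
  (forall w, differentiable f w) /\ continuous (grad f).

Definition C2 (R : realType) (N : nat) (f : 'rV[R]_N -> R) : Prop :=
  C1 f /\ forall i : 'I_N, C1 (fun w => grad f w i 0).

Definition C2vec (R : realType) (N k : nat) (g : 'rV[R]_N -> 'rV[R]_k) : Prop :=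
  forall j : 'I_k, C2 (fun w => g w 0 j).

(* minimize [obj w] subject to [ineqs w <= 0] and [eqs w = 0] *)
Record nlp (R : realType) (N k l : nat) := NLP {
  obj : 'rV[R]_N -> R;
  ineqs : 'rV[R]_N -> 'rV[R]_k;
  eqs : 'rV[R]_N -> 'rV[R]_l }.

Definition feasible (R : realType) (N k l : nat) (P : nlp R N k l)
    (w : 'rV[R]_N) : Prop :=
  (forall j, ineqs P w 0 j <= 0) /\ eqs P w = 0.

(* Only meaningful for problems with continuously differentiable data. *)
Definition KKT (R : realType) (N k l : nat) (P : nlp R N k l)
    (w : 'rV[R]_N) : Prop :=
  feasible P w /\
  exists (lam : 'rV[R]_k) (mu : 'rV[R]_l),
    [/\ forall j, 0 <= lam 0 j,
        grad (obj P) w + 'J (ineqs P) w *m lam^T + 'J (eqs P) w *m mu^T = 0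
      & dot lam (ineqs P w) = 0].

Section blocks.
Variables (R : realType) (n m p q : nat).

Definition pack (x : 'rV[R]_n) (y z : 'rV[R]_m) (u : 'rV[R]_p)
    (v : 'rV[R]_q) : 'rV[R]_(n + m + m + p + q) :=
  row_mx (row_mx (row_mx (row_mx x y) z) u) v.

Implicit Type w : 'rV[R]_(n + m + m + p + q).

Definition xpart w : 'rV[R]_n := lsubmx (lsubmx (lsubmx (lsubmx w))).
Definition ypart w : 'rV[R]_m := rsubmx (lsubmx (lsubmx (lsubmx w))).
Definition zpart w : 'rV[R]_m := rsubmx (lsubmx (lsubmx w)).
Definition upart w : 'rV[R]_p := rsubmx (lsubmx w).
Definition vpart w : 'rV[R]_q := rsubmx w.

End blocks.

Section duality.
Variables (R : realType) (n m p q : nat).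
Variables (F f : 'rV[R]_(n + m) -> R).
Variables (g : 'rV[R]_(n + m) -> 'rV[R]_p) (h : 'rV[R]_(n + m) -> 'rV[R]_q).

Definition zgrad_lagrangian (x : 'rV[R]_n) (z : 'rV[R]_m) (u : 'rV[R]_p)
    (v : 'rV[R]_q) : 'cV[R]_m :=
  grad (fun z' => f (row_mx x z')) z
  + 'J (fun z' => g (row_mx x z')) z *m u^T
  + 'J (fun z' => h (row_mx x z')) z *m v^T.

Definition WDP : nlp R (n + m + m + p + q) (p + 1 + p) (q + m) := {|
  obj := fun w => F (row_mx (xpart w) (ypart w));
  ineqs := fun w =>
    let x := xpart w in let y := ypart w in let z := zpart w in
    let u := upart w in let v := vpart w in
    row_mx (row_mx
      (g (row_mx x y))
      (const_mx (f (row_mx x y) - f (row_mx x z)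
                 - dot u (g (row_mx x z)) - dot v (h (row_mx x z)))))
      (- u);
  eqs := fun w =>
    let x := xpart w in let y := ypart w in let z := zpart w in
    let u := upart w in let v := vpart w in
    row_mx (h (row_mx x y)) (zgrad_lagrangian x z u v)^T |}.

Definition MDP : nlp R (n + m + m + p + q) (p + 1 + 1 + p) (q + m) := {|
  obj := fun w => F (row_mx (xpart w) (ypart w));
  ineqs := fun w =>
    let x := xpart w in let y := ypart w in let z := zpart w in
    let u := upart w in let v := vpart w in
    row_mx (row_mx (row_mx
      (g (row_mx x y))
      (const_mx (f (row_mx x y) - f (row_mx x z))))
      (const_mx (- (dot u (g (row_mx x z)) + dot v (h (row_mx x z))))))
      (- u);
  eqs := fun w =>
    let x := xpart w in let y := ypart w in let z := zpart w in
    let u := upart w in let v := vpart w in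
    row_mx (h (row_mx x y)) (zgrad_lagrangian x z u v)^T |}.

End duality.

(* Main.v *)
(** A WDP multiplier (a, b, c), with the scalar b attached to the inequality
    f(x,y) - f(x,z) - u^T g(x,z) - v^T h(x,z) <= 0, gives the MDP multiplier
    (a, b, b, c): the WDP inequality is the sum of the two MDP inequalities
    replacing it, so the WDP constraint map is the MDP one followed by a
    constant matrix. *)

Require Import Defs.
From mathcomp Require Import all_boot all_order all_algebra.
From mathcomp Require Import all_classical all_reals all_analysis.

Local Open Scope ring_scope.

Import GRing.Theory numFieldNormedType.Exports.

Section differentiability.
Context {R : realType} {V : normedModType R}.
Implicit Types w : V.

(** Writing [G] as the sum of its components times the constant vectors [delta_mx 0 j] reduces the
    claim to scalar maps, the form in which [C2vec] provides differentiability. *)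
Lemma differentiable_rV k (G : V -> 'rV[R]_k) w :
  (forall j, differentiable (fun w' => G w' 0 j) w) -> differentiable G w.
Proof.
move=> dG.
have -> : G = \sum_(j < k) (fun w' => G w' 0 j *: delta_mx 0 j).
  by apply/funext => w'; rewrite fct_sumE [LHS]row_sum_delta.
by apply: differentiable_sum => j; exact: differentiableZl.
Qed.

Lemma differentiable_component k (G : V -> 'rV[R]_k) w j :
  differentiable G w -> differentiable (fun w' => G w' 0 j) w.
Proof.
move=> dG; have dc := @differentiable_coord R _ _ (G w) 0 j.
exact: (differentiable_comp dG dc).
Qed.

Lemma differentiable_row_mx k l (G : V -> 'rV[R]_k) (H : V -> 'rV[R]_l) w :
  differentiable G w -> differentiable H w ->
  differentiable (fun w' => row_mx (G w') (H w')) w.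
Proof.
move=> dG dH; apply: differentiable_rV => j; case: (split_ordP j) => i ->.
- rewrite (_ : (fun _ => _) = (fun w' => G w' 0 i)); last first.
    by apply/funext => w'; rewrite row_mxEl.
  exact: differentiable_component.
- rewrite (_ : (fun _ => _) = (fun w' => H w' 0 i)); last first.
    by apply/funext => w'; rewrite row_mxEr.
  exact: differentiable_component.
Qed.

Lemma differentiable_const_mx k (s : V -> R) w :
  differentiable s w -> differentiable (fun w' => const_mx (s w') : 'rV[R]_k) w.
Proof.
move=> ds; apply: differentiable_rV => j.
by rewrite (_ : (fun _ => _) = s)//; apply/funext => w'; rewrite mxE.
Qed.

Lemma differentiable_dot k (G H : V -> 'rV[R]_k) w :
  differentiable G w -> differentiable H w ->
  differentiable (fun w' => dot (G w') (H w')) w.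
Proof.
move=> dG dH.
rewrite (_ : (fun _ => _) = \sum_(i < k) (fun w' => G w' 0 i * H w' 0 i)).
  apply: differentiable_sum => i.
  by apply: differentiableM; exact: differentiable_component.
by apply/funext => w'; rewrite fct_sumE.
Qed.

End differentiability.

Lemma differentiable_mulmxr (R : realType) k l (A : 'M[R]_(k, l)) (a : 'rV[R]_k) :
  differentiable (mulmxr A : 'rV[R]_k -> 'rV[R]_l) a.
Proof.
apply: differentiable_rV => j.
rewrite (_ : (fun _ => _) = fun b : 'rV[R]_k => dot b (row j A^T)).
  by apply: differentiable_dot.
by apply/funext => b; rewrite /= mxE; apply: eq_bigr => i _; rewrite !mxE.
Qed.

(** Chain rule: right multiplication by [A] is linear and continuous, hence its own differential.
    Row i of a Jacobian is the derivative along the i-th axis, so both sides are compared row by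
    row. *)
Lemma jacobian_mulmxr (R : realType) N k l (G : 'rV[R]_N -> 'rV[R]_k)
    (A : 'M[R]_(k, l)) (w : 'rV[R]_N) :
  differentiable G w -> 'J (fun w' => G w' *m A) w = 'J G w *m A.
Proof.
move=> dG; have dA := differentiable_mulmxr R k l A (G w).
apply/row_matrixP => i; rewrite row_mul !rowE.
rewrite -!deriveEjacobian//; last exact: (differentiable_comp dG dA).
rewrite !deriveE//; last exact: (differentiable_comp dG dA).
have := diff_comp dG dA => /(congr1 (fun f => f (delta_mx 0 i))) /= ->.
rewrite diff_lin// => a; apply: differentiable_continuous.
exact: differentiable_mulmxr.
Qed.

Lemma dot_mulmx (R : realType) k (a b : 'rV[R]_k) : dot a b = (b *m a^T) 0 0.
Proof. by rewrite mxE; apply: eq_bigr => i _; rewrite mxE mulrC. Qed.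

Section constraints.
Variables (R : realType) (n m p q : nat) (F f : 'rV[R]_(n + m) -> R).
Variables (g : 'rV[R]_(n + m) -> 'rV[R]_p) (h : 'rV[R]_(n + m) -> 'rV[R]_q).

(** Acting on the right of a row with blocks (a, s, t, c), this matrix gives (a, s + t, c): the row
    [row_mx 0 1%:M] sends t to the column that already receives s. *)
Definition merge_mx : 'M[R]_(p + 1 + 1 + p, p + 1 + p) :=
  block_mx (col_mx 1%:M (row_mx 0 1%:M)) 0 0 1%:M.

Lemma ineqs_WDP_MDP (w : 'rV[R]_(n + m + m + p + q)) :
  ineqs (WDP F f g h) w = ineqs (MDP F f g h) w *m merge_mx.
Proof.
rewrite /= mul_row_block !mulmx0 addr0 add0r mulmx1; congr row_mx.
rewrite mul_row_col mulmx1 mul_mx_row mulmx0 mulmx1 add_row_mx addr0.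
by congr row_mx; apply/rowP => i; rewrite !mxE opprD addrA.
Qed.

(** The adjoint of adding two entries is duplicating one. This explicit form shows that the
    transported multiplier has only entries of the old one, so its sign is preserved. *)
Lemma merge_mx_tr (a : 'rV[R]_p) (b : 'rV[R]_1) (c : 'rV[R]_p) :
  row_mx (row_mx a b) c *m merge_mx^T = row_mx (row_mx (row_mx a b) b) c.
Proof.
rewrite /merge_mx tr_block_mx mul_row_block !trmx0 !mulmx0 addr0 add0r.
rewrite trmx1 mulmx1 tr_col_mx mul_mx_row trmx1 mulmx1 tr_row_mx mul_row_col.
by rewrite trmx0 trmx1 mulmx0 add0r mulmx1.
Qed.

Lemma differentiable_ineqs_MDP (w : 'rV[R]_(n + m + m + p + q)) :
  (forall a, differentiable f a) -> (forall a, differentiable g a) ->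
  (forall a, differentiable h a) -> differentiable (ineqs (MDP F f g h)) w.
Proof.
move=> df dg dh.
have dl k l := @differentiable_lsubmx R 1 k l.
have dr k l := @differentiable_rsubmx R 1 k l.
have dl2 := differentiable_comp (dl _ _ w) (dl _ _ _).
have dl3 := differentiable_comp dl2 (dl _ _ _).
have dx : differentiable (@xpart R n m p q) w := differentiable_comp dl3 (dl _ _ _).
have dy : differentiable (@ypart R n m p q) w := differentiable_comp dl3 (dr _ _ _).
have dz : differentiable (@zpart R n m p q) w := differentiable_comp dl2 (dr _ _ _).
have du : differentiable (@upart R n m p q) w :=
  differentiable_comp (dl _ _ w) (dr _ _ _).
have dv : differentiable (@vpart R n m p q) w := dr _ _ w.
have dxy := differentiable_row_mx _ _ _ _ _ dx dy.
have dxz := differentiable_row_mx _ _ _ _ _ dx dz.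
apply: differentiable_row_mx; last exact: differentiableN.
apply: differentiable_row_mx; first apply: differentiable_row_mx.
- exact: (differentiable_comp dxy (dg _)).
- apply/differentiable_const_mx/differentiableB.
    exact: (differentiable_comp dxy (df _)).
  exact: (differentiable_comp dxz (df _)).
- apply/differentiable_const_mx/differentiableN/differentiableD.
    exact: (differentiable_dot _ _ _ _ du (differentiable_comp dxz (dg _))).
  exact: (differentiable_dot _ _ _ _ dv (differentiable_comp dxz (dh _))).
Qed.

End constraints.

Theorem theorem5p1 (R : realType) (n m p q : nat)
    (F f : 'rV[R]_(n + m) -> R)
    (g : 'rV[R]_(n + m) -> 'rV[R]_p) (h : 'rV[R]_(n + m) -> 'rV[R]_q)
    (hF : C1 F) (hf : C2 f) (hg : C2vec g) (hh : C2vec h)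
    (x : 'rV[R]_n) (y z : 'rV[R]_m) (u : 'rV[R]_p) (v : 'rV[R]_q) :
  KKT (WDP F f g h) (pack x y z u v) ->
  feasible (MDP F f g h) (pack x y z u v) ->
  KKT (MDP F f g h) (pack x y z u v).
Proof.
set w := pack x y z u v => -[_ [lam [mu [lam_ge0 stat compl]]]] feas.
split=> //.
have dI : differentiable (ineqs (MDP F f g h)) w.
  apply: differentiable_ineqs_MDP => a; first by case: hf => -[].
  - by apply: differentiable_rV => j; case: (hg j) => -[].
  - by apply: differentiable_rV => j; case: (hh j) => -[].
have JE : 'J (ineqs (WDP F f g h)) w =
    'J (ineqs (MDP F f g h)) w *m merge_mx R p.
  (* The two constraint maps are related at every point, not only at [w], so the relation may be
     differentiated. *)
  rewrite -(jacobian_mulmxr _ _ _ _ _ (merge_mx R p) _ dI); congr ('J _ w).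
  by apply/funext => w'; exact: ineqs_WDP_MDP.
(* With A the merging matrix, J A lam^T = J (lam A^T)^T, which dictates the new inequality
   multiplier. The objective and the equality constraints are common to both problems, so [mu] is
   kept. *)
exists (lam *m (merge_mx R p)^T), mu; split.
- rewrite -[lam]hsubmxK -[lsubmx lam]hsubmxK merge_mx_tr => j.
  have lamll i : 0 <= lsubmx (lsubmx lam) 0 i by rewrite !mxE.
  have lamlr i : 0 <= rsubmx (lsubmx lam) 0 i by rewrite !mxE.
  case: (split_ordP j) => {}j ->; last by rewrite row_mxEr mxE.
  rewrite row_mxEl; case: (split_ordP j) => {}j ->; last by rewrite row_mxEr.
  rewrite row_mxEl.
  by case: (split_ordP j) => {}j ->; rewrite ?row_mxEl ?row_mxEr.
- rewrite trmx_mul trmxK mulmxA -JE; exact: stat.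
(* Complementarity moves across by adjointness: pairing lam A^T with the MDP constraints equals
   pairing [lam] with their image under A, the WDP constraints. *)
- by rewrite dot_mulmx trmx_mul trmxK mulmxA -ineqs_WDP_MDP -dot_mulmx.
Qed.
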